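(* Let $B=K_{1,2,2}$. Then $\omega(\gamma^{4})\le f_B(\gamma)\le\gamma^{3-o(1)}$, where the $o(1)$ term goes to $0$ and the $\omega(1)$ factor goes to infinity as $\gamma\to0$. That is: (i) $f_B(\gamma)/\gamma^4\to\infty$ as $\gamma\to 0$; and (ii) for every $\varepsilon>0$ there is $\gamma_0>0$ such that $f_B(\gamma)\le\gamma^{3-\varepsilon}$ for all $0<\gamma<\gamma_0$.
   Context: Graphs are finite and simple. For a fixed graph $H$ on $h$ vertices and a graph $G$ on $n$ vertices, $Hom_H(G)$ is the number of homomorphisms from $H$ to $G$, i.e. (not necessarily injective) mappings $V(H)\to V(G)$ which map edges of $H$ to edges of $G$. The $H$-density of $G$ is $d_H(G)=Hom_H(G)/n^h$. $K_{a,b,c}$ denotes the complete 3-partite graph with parts of sizes $a,b,c$ (the $(a,b,c)$-blowup of the triangle $K_3$). Densities are understood asymptotically (up to $o(1)$ as the number of vertices tends to infinity). For $B=K_{a,b,c}$ and $0<\gamma<1$, $f_B(\gamma)$ denotes the infimum of the asymptotic $B$-density over all graphs with asymptotic triangle density $\gamma$. Precisely, $f_B(\gamma)$ is the infimum of all $\beta$ for which there is a sequence of graphs $(G_i)$ with $|V(G_i)|\to\infty$, $d_{K_3}(G_i)\to\gamma$ and $d_B(G_i)\to\beta$. *)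

(* Defs.v *)
From HB Require Import structures.
From mathcomp Require Import all_boot all_order all_algebra.
From mathcomp Require Import all_classical all_reals all_analysis.

Set Implicit Arguments.
Unset Strict Implicit.
Unset Printing Implicit Defensive.

Import Order.TTheory GRing.Theory Num.Theory.
Import numFieldNormedType.Exports.

Local Open Scope classical_set_scope.
Local Open Scope ring_scope.

Record sgraph := SGraph {
  vertex :> finType;
  adj : rel vertex;
  adj_sym : symmetric adj;
  adj_irrefl : irreflexive adj
}.

Definition is_hom (H G : sgraph) (f : {ffun H -> G}) : bool :=
  [forall x : H, forall y : H, adj x y ==> adj (f x) (f y)].

Definition num_hom (H G : sgraph) : nat := #|[pred f : {ffun H -> G} | is_hom f]|.

Definition density (R : realType) (H G : sgraph) : R :=
  (num_hom H G)%:R / (#|G|%:R ^+ #|H|).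

Definition complete_adj (n : nat) : rel 'I_n := fun x y => x != y.

Lemma complete_adj_sym (n : nat) : symmetric (@complete_adj n).
Proof. by move=> x y; rewrite /complete_adj eq_sym. Qed.

Lemma complete_adj_irrefl (n : nat) : irreflexive (@complete_adj n).
Proof. by move=> x; rewrite /complete_adj eqxx. Qed.

Definition complete_graph (n : nat) : sgraph :=
  SGraph (@complete_adj_sym n) (@complete_adj_irrefl n).

Definition tripart (a b c : nat) (x : 'I_a + 'I_b + 'I_c) : nat :=
  match x with
  | inl (inl _) => 0%N
  | inl (inr _) => 1%N
  | inr _ => 2%N
  end.

Definition tripartite_adj (a b c : nat) : rel ('I_a + 'I_b + 'I_c)%type :=
  fun x y => tripart x != tripart y.

Lemma tripartite_adj_sym (a b c : nat) : symmetric (@tripartite_adj a b c).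
Proof. by move=> x y; rewrite /tripartite_adj eq_sym. Qed.

Lemma tripartite_adj_irrefl (a b c : nat) :
  irreflexive (@tripartite_adj a b c).
Proof. by move=> x; rewrite /tripartite_adj eqxx. Qed.

Definition complete_tripartite (a b c : nat) : sgraph :=
  SGraph (@tripartite_adj_sym a b c) (@tripartite_adj_irrefl a b c).

(* For 0 < gamma < 1 the set below is nonempty and bounded below by 0, so the
   default value 0 of [inf] plays no role there. *)
Definition min_density (R : realType) (B : sgraph) (gamma : R) : R :=
  inf [set beta : R | exists G : nat -> sgraph,
    [/\ #|G i| @[i --> \oo] --> \oo,
        density R (complete_graph 3) (G i) @[i --> \oo] --> gamma
      & density R B (G i) @[i --> \oo] --> beta]].

(* Main.v *)
(* Lower bound.  By the triangle removal lemma, a graph with few triangles has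
   a set of at most [delta * n^2] edges meeting all of them.  Cauchy-Schwarz on
   these edges bounds the number of [K_{1,1,2}] from below by a constant times
   [T^2 / (delta * n^2)], where [T] is the number of triangles, and a second
   Cauchy-Schwarz, over the triples consisting of the apex and the doubled pair,
   gives [T^4 <= 81 * delta^2 * n^7 * hom(K_{1,2,2})] for every [delta] as soon
   as the triangle density is small enough.

   Upper bound.  If every edge of a graph on [n] vertices lies in at most one
   triangle, every homomorphic copy of [K_{1,2,2}] collapses to a triangle and
   there are at most [n^2] of them.  Such a graph with triangle density about
   [n^(-1-o(1))] is obtained as in the constructions of Ruzsa-Szemeredi and
   Behrend: join points of three copies of a box in [Z^k] along directions taken
   from a large sphere, which contains no nontrivial midpoints. *)

Require Import Defs.
From HB Require Import structures.
From mathcomp Require Import all_boot all_order all_algebra.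
From mathcomp Require Import all_classical all_reals all_analysis.
From mathcomp Require Import ring lra zify.

Set Implicit Arguments.
Unset Strict Implicit.
Unset Printing Implicit Defensive.

Import Order.TTheory GRing.Theory Num.Theory.
Import numFieldNormedType.Exports.

Local Open Scope classical_set_scope.
Local Open Scope ring_scope.

(** * Szemeredi regularity *)

Section Regularity.
Context {R : realType} {V : finType}.
Implicit Types (g : V -> V -> R).

Definition cell (I : finType) (c : V -> I) (i : I) : {set V} :=
  [set x | c x == i]%SET.

Definition weight (I : finType) (c : V -> I) (i : I) : R := #|cell c i|%:R.

(** The potential of an energy-increment argument, in decreasing form. The approximant [phi] is
    arbitrary rather than made of cell averages, so progress comes from correcting it directly. *)
Definition residual g (I : finType) (c : V -> I) (phi : I -> I -> R) : R :=
  \sum_x \sum_y (g x y - phi (c x) (c y)) ^+ 2.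

(** A cut-norm bound: the error is measured against the whole pair of cells, so [A] and [B] carry no
    minimum size. *)
Definition regular (eps : R) g (I : finType) (c : V -> I) (phi : I -> I -> R)
    (i j : I) : bool :=
  [forall A : {set V}, forall B : {set V},
    `|\sum_(x in cell c i :&: A) \sum_(y in cell c j :&: B) (g x y - phi i j)|
      <= eps * weight c i * weight c j].

Definition irregular_mass eps g (I : finType) (c : V -> I) phi : R :=
  \sum_i \sum_(j | ~~ regular eps g c phi i j) weight c i * weight c j.

Lemma weight_ge0 (I : finType) (c : V -> I) i : 0 <= weight c i.
Proof. exact: ler0n. Qed.

Lemma residual_ge0 g (I : finType) (c : V -> I) phi : 0 <= residual g c phi.
Proof. by apply: sumr_ge0 => x _; apply: sumr_ge0 => y _; apply: sqr_ge0. Qed.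

Lemma sum_weight (I : finType) (c : V -> I) : \sum_i weight c i = #|V|%:R.
Proof.
rewrite -natr_sum; congr (_%:R); rewrite -sum1_card (partition_big c predT) //=.
by apply: eq_bigr => i _; rewrite -sum1_card; apply: eq_bigl => x; rewrite inE.
Qed.

Lemma sum_cells (I : finType) (c : V -> I) (F : V -> V -> R) :
  \sum_x \sum_y F x y =
  \sum_i \sum_j \sum_(x in cell c i) \sum_(y in cell c j) F x y.
Proof.
rewrite (partition_big c predT) //=; apply: eq_bigr => i _.
rewrite [RHS]exchange_big /=; rewrite (eq_bigl (fun x => x \in cell c i));
  last by move=> x; rewrite inE.
apply: eq_bigr => x _; rewrite (partition_big c predT) //=.
by apply: eq_bigr => j _; apply: eq_bigl => y; rewrite inE.
Qed.

Lemma sum_cells_const (I : finType) (c : V -> I) i j (a : R) :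
  \sum_(x in cell c i) \sum_(y in cell c j) a = a * weight c i * weight c j.
Proof.
by rewrite !sumr_const /weight -[a *+ _]mulr_natr -[LHS]mulr_natr mulrAC.
Qed.

Lemma sum_setI_cells (I : finType) (c : V -> I) i j (A B : {set V}) (F : V -> V -> R) :
  \sum_(x in cell c i) \sum_(y in cell c j) ((x \in A) && (y \in B))%:R * F x y =
  \sum_(x in cell c i :&: A) \sum_(y in cell c j :&: B) F x y.
Proof.
rewrite [RHS](eq_bigl (fun x => (x \in cell c i) && (x \in A))); last first.
  by move=> x; rewrite !inE.
rewrite [RHS]big_mkcondr /=; apply: eq_bigr => x _.
case: (x \in A) => /=; last by rewrite big1 // => y _; rewrite mul0r.
rewrite [RHS](eq_bigl (fun x => (x \in cell c j) && (x \in B))); last first.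
  by move=> y; rewrite !inE.
rewrite [RHS]big_mkcondr /=; apply: eq_bigr => y _.
by case: (y \in B); rewrite ?mul1r ?mul0r.
Qed.

Lemma sum_indicator_le (I : finType) (c : V -> I) i j (A B : {set V}) :
  \sum_(x in cell c i) \sum_(y in cell c j) ((x \in A) && (y \in B))%:R
    <= weight c i * weight c j :> R.
Proof.
rewrite -[leRHS](mul1r _) mulrA -sum_cells_const.
by apply: ler_sum => x _; apply: ler_sum => y _; case: (_ && _); rewrite ?ler01.
Qed.

(* Adding [eps * s] on the box [A x B] changes the squared error of the cell
   by minus the quantity bounded from below here. *)
Lemma correction_exists (eps : R) g (I : finType) (c : V -> I) phi i j :
  0 < eps ->
  exists t : {set V} * {set V} * R,
    (if regular eps g c phi i j then 0 else eps ^+ 2 * (weight c i * weight c j))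
    <= \sum_(x in cell c i) \sum_(y in cell c j)
         ((x \in t.1.1) && (y \in t.1.2))%:R *
         (2 * eps * t.2 * (g x y - phi i j) - (eps * t.2) ^+ 2).
Proof.
move=> eps0; case: ifPn => [_|].
  exists (finset.set0, finset.set0, 0) => /=.
  by apply: sumr_ge0 => x _; apply: sumr_ge0 => y _; rewrite finset.in_set0 mul0r.
rewrite negb_forall => /existsP[A]; rewrite negb_forall => /existsP[B].
rewrite -ltNge -sum_setI_cells => irr.
set D := \sum_(x in _) _ in irr.
(* The correction follows the sign of the discrepancy [D]. With w the product of the two weights, it
   gains 2 * eps * |D| >= 2 * eps ^ 2 * w and loses at most eps ^ 2 * w. *)
exists (A, B, Num.sg D) => /=.
have D0 : D != 0.
  apply: contraTneq irr => ->; rewrite normr0 -leNgt.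
  by rewrite !mulr_ge0 ?weight_ge0 ?ltW.
have sg1 : Num.sg D ^+ 2 = 1 by rewrite sqr_sg D0.
under eq_bigr => x _ do under eq_bigr => y _ do
  rewrite exprMn sg1 mulr1 mulrBr (mulrCA _ (2 * eps * Num.sg D)).
under eq_bigr => x _ do rewrite sumrB -mulr_sumr -mulr_suml.
rewrite sumrB -mulr_sumr -mulr_suml -/D -[2 * eps * _ * D]mulrA -normrEsg.
have := sum_indicator_le c i j A B.
set X := \sum_(x in _) _ => hX.
have h1 : X * eps ^+ 2 <= weight c i * weight c j * eps ^+ 2.
  by rewrite ler_wpM2r // sqr_ge0.
have h2 : eps * (eps * weight c i * weight c j) <= eps * `|D|.
  by rewrite ler_wpM2l // ltW.
nra.
Qed.

(** All pairs of cells are corrected at once. Each irregular pair gains eps ^ 2 times its weight,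
    and these weights sum to more than eps * n ^ 2. Every vertex records its membership in two sets
    per pair of cells, whence the factor 4 ^ (|I| ^ 2). *)
Lemma residual_decrement (eps : R) g (I : finType) (c : V -> I) phi :
  0 < eps -> eps * #|V|%:R ^+ 2 < irregular_mass eps g c phi ->
  exists (J : finType) (c' : V -> J) phi',
    #|J| = (#|I| * 4 ^ (#|I| * #|I|))%N /\
    residual g c' phi' <= residual g c phi - eps ^+ 3 * #|V|%:R ^+ 2.
Proof.
move=> eps0 hirr.
have [t ht] := choice (fun ij : I * I => correction_exists g c phi ij.1 ij.2 eps0).
pose c' x := (c x, [ffun ij => (x \in (t ij).1.1, x \in (t ij).1.2)]).
pose phi' (u v : I * {ffun I * I -> bool * bool}) : R :=
  phi u.1 v.1 +
  ((u.2 (u.1, v.1)).1 && (v.2 (u.1, v.1)).2)%:R * (eps * (t (u.1, v.1)).2).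
exists _, c', phi'; split.
  by rewrite card_prod card_ffun !card_prod card_bool.
pose gain x y := ((x \in (t (c x, c y)).1.1) && (y \in (t (c x, c y)).1.2))%:R *
   (2 * eps * (t (c x, c y)).2 * (g x y - phi (c x) (c y)) - (eps * (t (c x, c y)).2) ^+ 2).
have -> : residual g c' phi' = residual g c phi - \sum_x \sum_y gain x y.
  rewrite /residual -sumrB; apply: eq_bigr => x _; rewrite -sumrB; apply: eq_bigr => y _.
  rewrite /phi' /gain /= !ffunE /=.
  by case: (_ && _); rewrite /=; ring.
rewrite lerD2l lerN2 (sum_cells c).
apply: (@le_trans _ _ (eps ^+ 2 * irregular_mass eps g c phi)).
  by rewrite exprSr -mulrA ler_wpM2l ?sqr_ge0 // ltW.
rewrite /irregular_mass mulr_sumr; apply: ler_sum => i _.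
rewrite mulr_sumr big_mkcond; apply: ler_sum => j _.
have -> : \sum_(x in cell c i) \sum_(y in cell c j) gain x y =
  \sum_(x in cell c i) \sum_(y in cell c j)
         ((x \in (t (i, j)).1.1) && (y \in (t (i, j)).1.2))%:R *
         (2 * eps * (t (i, j)).2 * (g x y - phi i j) - (eps * (t (i, j)).2) ^+ 2).
  apply: eq_bigr => x; rewrite inE => /eqP xi.
  by apply: eq_bigr => y; rewrite inE => /eqP yj; rewrite /gain xi yj.
by have := ht (i, j) => /=; case: (regular _ _ _ _ _ _).
Qed.

End Regularity.

Definition refined_size (m : nat) : nat := (m * 4 ^ (m * m))%N.

Lemma leq_refined_size m n : (m <= n)%N -> (refined_size m <= refined_size n)%N.
Proof. by move=> mn; rewrite leq_mul // leq_pexp2l // leq_mul. Qed.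

Lemma refined_size_ge m : (m <= refined_size m)%N.
Proof. by rewrite leq_pmulr // expn_gt0. Qed.

(** [k] counts the decrements eps ^ 3 * n ^ 2 that the residual can still afford. Since it stays
    nonnegative, refinement stops after at most [k] rounds. *)
Lemma regularity_iter (R : realType) (V : finType) (g : V -> V -> R) (eps : R)
    (k m : nat) (I : finType) (c : V -> I) (phi : I -> I -> R) :
  0 < eps -> (#|I| <= m)%N ->
  residual g c phi <= k%:R * (eps ^+ 3 * #|V|%:R ^+ 2) ->
  exists (J : finType) (c' : V -> J) phi',
    (#|J| <= iter k refined_size m)%N /\
    irregular_mass eps g c' phi' <= eps * #|V|%:R ^+ 2.
Proof.
move=> eps0; elim: k m I c phi => [|k IH] m I c phi Im.
  rewrite mul0r => res0; exists I, c, phi; split=> //.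
  rewrite leNgt; apply/negP => irr.
  have [J [c' [phi' [_]]]] := residual_decrement eps0 irr.
  have := residual_ge0 g c' phi'.
  have n0 : 0 <= eps ^+ 3 * #|V|%:R ^+ 2 by rewrite mulr_ge0 ?exprn_ge0 // ltW.
  (* For empty [V] the decrement is zero, but so is the irregular mass, against the strict
     inequality [irr]. *)
  have [V0|Vpos] := posnP #|V|.
    move: irr; rewrite V0 expr0n mulr0 /irregular_mass big1 ?ltxx // => i _.
    rewrite big1 // => j _; suff -> : weight c i = 0 :> R by rewrite mul0r.
    by apply/eqP; rewrite pnatr_eq0 -leqn0 -V0 max_card.
  have : 0 < eps ^+ 3 * #|V|%:R ^+ 2 by rewrite mulr_gt0 ?exprn_gt0 ?ltr0n.
  lra.
move=> resk.
have [reg|irr] := leP (irregular_mass eps g c phi) (eps * #|V|%:R ^+ 2).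
  exists I, c, phi; split=> //; rewrite (leq_trans Im) //.
  elim: (k.+1) => //= l IHl; exact: leq_trans IHl (refined_size_ge _).
have [J [c' [phi' [Jcard res']]]] := residual_decrement eps0 irr.
rewrite iterSr; apply: (IH (refined_size m) J c' phi').
  by rewrite Jcard leq_refined_size.
move: resk; rewrite -natr1 mulrDl mul1r; lra.
Qed.

Lemma regularity (R : realType) (eps : R) : 0 < eps ->
  exists M : nat, forall (V : finType) (g : V -> V -> R),
    (forall x y, 0 <= g x y <= 1) ->
    exists (I : finType) (c : V -> I) phi,
      (#|I| <= M)%N /\ irregular_mass eps g c phi <= eps * #|V|%:R ^+ 2.
Proof.
(* The one-cell partition with zero approximant has residual at most n ^ 2, which is at most [k]
   decrements. *)
move=> eps0; pose k := (Num.truncn (eps ^+ 3)^-1).+1.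
exists (iter k refined_size 1) => V g g01.
apply: (@regularity_iter R V g eps k 1 unit (fun=> tt) (fun _ _ => 0)) => //.
  by rewrite card_unit.
apply: (@le_trans _ _ (#|V|%:R ^+ 2)).
  rewrite /residual; under eq_bigr => x _ do under eq_bigr => y _ do rewrite subr0.
  apply: (@le_trans _ _ (\sum_(x : V) \sum_(y : V) 1)).
    apply: ler_sum => x _; apply: ler_sum => y _.
    by have /andP[h0 h1] := g01 x y; rewrite expr_le1.
  by rewrite !sumr_const -[leLHS]mulr_natr expr2.
rewrite mulrA -[leLHS]mul1r ler_wpM2r ?sqr_ge0 //.
rewrite -ler_pdivrMr ?exprn_gt0 // mul1r ltW //.
exact: truncnS_gt.
Qed.

(** * Triangle removal *)

Section TriangleRemoval.
Context {R : realType} {V : finType}.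
Variables (e : rel V) (I : finType) (c : V -> I) (phi : I -> I -> R) (eps : R).

Let g x y : R := (e x y)%:R.

Lemma regular_lower i j (A B : {set V}) : regular eps g c phi i j ->
  - (eps * weight c i * weight c j) <=
  \sum_(x in cell c i) \sum_(y in cell c j)
     ((x \in A) && (y \in B))%:R * (g x y - phi i j).
Proof.
move=> /forallP/(_ A)/forallP/(_ B); rewrite -sum_setI_cells.
by rewrite ler_norml => /andP[].
Qed.

Lemma regular_edges_le i j : regular eps g c phi i j ->
  \sum_(x in cell c i) \sum_(y in cell c j) g x y
    <= (phi i j + eps) * (weight c i * weight c j).
Proof.
move=> /forallP/(_ finset.setT)/forallP/(_ finset.setT); rewrite -sum_setI_cells.
under eq_bigr => x _ do under eq_bigr => y _ do rewrite !finset.in_setT mul1r.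
under eq_bigr => x _ do rewrite sumrB.
rewrite sumrB sum_cells_const ler_norml => /andP[_]; lra.
Qed.

Lemma sum_cell_ge i (a : R) (F : V -> R) : (forall x, a <= F x) ->
  a * weight c i <= \sum_(x in cell c i) F x.
Proof.
move=> aF; rewrite /weight mulr_natr -sumr_const; exact: ler_sum.
Qed.

Definition triangles_in i j k : R :=
  \sum_(x in cell c i) \sum_(y in cell c j) \sum_(z in cell c k)
    [&& e x y, e y z & e x z]%:R.

(* The edges xy, yz, xz are replaced one after the other by the densities
   phi i j, phi j k, phi i k. *)
Lemma triangle_counting i j k (d : R) :
  0 < d -> d <= 1 -> eps = d ^+ 3 / 6 ->
  regular eps g c phi i j -> regular eps g c phi j k -> regular eps g c phi i k ->
  d <= phi i j -> d <= phi j k -> d <= phi i k ->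
  d ^+ 3 / 2 * (weight c i * weight c j * weight c k) <= triangles_in i j k.
Proof.
move=> d0 d1 epsE rij rjk rik dij djk dik.
set W := weight c i * weight c j * weight c k.
have W0 : 0 <= W by rewrite !mulr_ge0 ?weight_ge0.
pose T2 : R := \sum_(x in cell c i) \sum_(y in cell c j) \sum_(z in cell c k) (e x z && e y z)%:R.
pose T3 : R := \sum_(x in cell c i) \sum_(y in cell c j) \sum_(z in cell c k) (e x z)%:R.
(* For fixed z the other two edges confine (x, y) to a box, the neighbourhood of z on both sides, so
   regularity of (i, j) applies. The next two replacements fix x and y in the same way. *)
have H1 : - eps * W <= triangles_in i j k - phi i j * T2.
  have -> : triangles_in i j k - phi i j * T2 = \sum_(z in cell c k)
     \sum_(x in cell c i) \sum_(y in cell c j)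
      ((x \in [set x | e x z]%SET) && (y \in [set y | e y z]%SET))%:R * (g x y - phi i j).
    rewrite /triangles_in /T2 mulr_sumr -sumrB [RHS]exchange_big /=; apply: eq_bigr => x _.
    rewrite mulr_sumr -sumrB [RHS]exchange_big /=; apply: eq_bigr => y _.
    rewrite mulr_sumr -sumrB; apply: eq_bigr => z _; rewrite !inE /g.
    by case: (e x y); case: (e y z); case: (e x z); rewrite /=; ring.
  have -> : - eps * W = - (eps * weight c i * weight c j) * weight c k by rewrite /W; ring.
  by apply: sum_cell_ge => z; apply: regular_lower.
have H2 : - eps * W <= T2 - phi j k * T3.
  have -> : T2 - phi j k * T3 = \sum_(x in cell c i)
     \sum_(y in cell c j) \sum_(z in cell c k)
      ((y \in finset.setT) && (z \in [set z | e x z]%SET))%:R * (g y z - phi j k).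
    rewrite /T2 /T3 mulr_sumr -sumrB; apply: eq_bigr => x _.
    rewrite mulr_sumr -sumrB; apply: eq_bigr => y _.
    rewrite mulr_sumr -sumrB; apply: eq_bigr => z _; rewrite !inE /g.
    by case: (e y z); case: (e x z); rewrite /=; ring.
  have -> : - eps * W = - (eps * weight c j * weight c k) * weight c i by rewrite /W; ring.
  by apply: sum_cell_ge => z; apply: regular_lower.
have H3 : - eps * W <= T3 - phi i k * W.
  have -> : T3 - phi i k * W = \sum_(y in cell c j)
     \sum_(x in cell c i) \sum_(z in cell c k)
      ((x \in finset.setT) && (z \in finset.setT))%:R * (g x z - phi i k).
    under [RHS]eq_bigr => y _ do (under eq_bigr => x _ do
      (under eq_bigr => z _ do rewrite !finset.in_setT mul1r; rewrite sumrB);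
      rewrite sumrB sum_cells_const).
    rewrite sumrB; congr (_ - _); first by rewrite /T3 exchange_big.
    by rewrite sumr_const -[RHS]mulr_natr /W /weight; ring.
  have -> : - eps * W = - (eps * weight c i * weight c k) * weight c j by rewrite /W; ring.
  by apply: sum_cell_ge => z; apply: regular_lower.
have eps0 : 0 < eps by rewrite epsE divr_gt0 ?exprn_gt0.
have d2 : d ^+ 2 <= d by rewrite expr2 ler_piMl // ltW.
have d3 : d ^+ 3 <= d ^+ 2 by rewrite exprS ler_piMl // sqr_ge0.
have K3 : (d - eps) * W <= T3.
  have : d * W <= phi i k * W by rewrite ler_wpM2r.
  lra.
have p3 : 0 <= (d - eps) * W by rewrite mulr_ge0 // subr_ge0 epsE; lra.
have K2 : (d * (d - eps) - eps) * W <= T2.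
  have : d * ((d - eps) * W) <= phi j k * T3.
    by apply: ler_pM => //; apply: ltW.
  lra.
have p2 : 0 <= (d * (d - eps) - eps) * W.
  rewrite mulr_ge0 //.
  have : d * eps <= eps by rewrite ler_piMl // ltW.
  have : eps <= d ^+ 2 / 6 by rewrite epsE; lra.
  have : 0 <= d ^+ 2 by rewrite sqr_ge0.
  rewrite mulrBr -expr2; lra.
have K1 : (d * (d * (d - eps) - eps) - eps) * W <= triangles_in i j k.
  have : d * ((d * (d - eps) - eps) * W) <= phi i j * T2.
    by apply: ler_pM => //; apply: ltW.
  lra.
apply: le_trans K1; rewrite ler_wpM2r //.
have h1 : d * eps <= eps by rewrite ler_piMl // ltW.
have h2 : d ^+ 2 * eps <= eps by rewrite ler_piMl ?(le_trans d2) // ltW.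
(* Each of the three replacements costs at most eps, so eps = d ^ 3 / 6 leaves d ^ 3 / 2. *)
have -> : d * (d * (d - eps) - eps) - eps = d ^+ 3 - d ^+ 2 * eps - d * eps - eps by ring.
have : eps = d ^+ 3 / 6 by [].
lra.
Qed.

Lemma triangles_in_le i j k :
  triangles_in i j k <= \sum_x \sum_y \sum_z [&& e x y, e y z & e x z]%:R.
Proof.
have sub (F : V -> R) l : (forall x, 0 <= F x) -> \sum_(x in cell c l) F x <= \sum_x F x.
  by move=> F0; rewrite [leLHS]big_mkcond; apply: ler_sum => x _; case: ifP.
apply: le_trans (sub _ _ _); last first.
  by move=> x; apply: sumr_ge0 => y _; apply: sumr_ge0.
apply: ler_sum => x _; apply: le_trans (sub _ _ _); last first.
  by move=> y; apply: sumr_ge0.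
by apply: ler_sum => y _; apply: sub.
Qed.

Lemma sum_weight_mul : \sum_i \sum_j weight c i * weight c j = #|V|%:R ^+ 2 :> R.
Proof.
by under eq_bigr => i _ do rewrite -mulr_sumr; rewrite -mulr_suml sum_weight.
Qed.

Lemma sparse_edges_le (d : R) : 0 <= d + eps ->
  \sum_x \sum_y (e x y && regular eps g c phi (c x) (c y) && (phi (c x) (c y) < d))%:R
    <= (d + eps) * #|V|%:R ^+ 2 :> R.
Proof.
move=> de0; rewrite (sum_cells c) -sum_weight_mul mulr_sumr.
apply: ler_sum => i _; rewrite mulr_sumr; apply: ler_sum => j _.
have W0 : 0 <= weight c i * weight c j :> R by rewrite mulr_ge0 ?weight_ge0.
have [/andP[rij dij]|bad] := boolP (regular eps g c phi i j && (phi i j < d)).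
  apply: le_trans (le_trans (regular_edges_le rij) _); last first.
    by rewrite ler_wpM2r // lerD2r ltW.
  apply: ler_sum => x _; apply: ler_sum => y _; rewrite /g ler_nat.
  by case: (e x y); rewrite ?leq_b1.
rewrite big1 ?mulr_ge0 // => x; rewrite inE => /eqP xi.
rewrite big1 // => y; rewrite inE => /eqP yj.
by rewrite xi yj -andbA (negbTE bad) andbF.
Qed.

Lemma irregular_edges :
  \sum_x \sum_y (~~ regular eps g c phi (c x) (c y))%:R = irregular_mass eps g c phi.
Proof.
rewrite (sum_cells c); apply: eq_bigr => i _; rewrite [RHS]big_mkcond.
apply: eq_bigr => j _.
rewrite (eq_bigr (fun=> \sum_(y in cell c j) (~~ regular eps g c phi i j)%:R)).
  by rewrite sum_cells_const -mulrA; case: (regular _ _ _ _ _ _); rewrite ?mul1r ?mul0r.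
move=> x; rewrite inE => /eqP ->; apply: eq_bigr => y; by rewrite inE => /eqP ->.
Qed.

Lemma small_cells_le (s : R) : 0 <= s ->
  \sum_x (weight c (c x) < s)%R%:R <= #|I|%:R * s :> R.
Proof.
move=> s0; rewrite (partition_big c predT) //=.
rewrite -[leRHS]mulrC mulr_natr -sumr_const; apply: ler_sum => i _.
rewrite (eq_bigr (fun=> (weight c i < s)%R%:R)); last by move=> x /eqP ->.
rewrite (eq_bigl (fun x => x \in cell c i)); last by move=> x; rewrite inE.
rewrite sumr_const -[leLHS]mulr_natr -/(weight c i).
by case: ltP => [/ltW|]; rewrite ?mul1r ?mul0r.
Qed.

End TriangleRemoval.

(** [S] collects the pairs in irregular cell pairs, the edges in regular pairs of density below d,
    and the pairs meeting a small cell. A triangle missed by [S] lies in large, pairwise regular and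
    dense cells, where [triangle_counting] produces too many triangles. *)
Lemma triangle_removal (R : realType) (delta : R) : 0 < delta ->
  exists2 gam : R, 0 < gam &
    forall (V : finType) (e : rel V),
      \sum_x \sum_y \sum_z [&& e x y, e y z & e x z]%:R < gam * #|V|%:R ^+ 3 ->
      exists S : rel V,
        \sum_x \sum_y (S x y)%:R <= delta * #|V|%:R ^+ 2 /\
        (forall x y z, e x y -> e y z -> e x z -> [|| S x y, S y z | S x z]).
Proof.
(* The budget is five times d: irregular pairs cost eps <= d, sparse pairs d + eps <= 2 * d, small
   cells d at either end. The minimum with 1 provides d <= 1 for the counting. *)
move=> delta0; pose d := Num.min delta 1 / 5.
have d0 : 0 < d by rewrite divr_gt0 // lt_min delta0 ltr01.
have dd : 5 * d <= delta.
  by rewrite /d mulrC divfK ?pnatr_eq0 // ge_min lexx.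
have d1 : d <= 1.
  have : Num.min delta 1 <= 1 by rewrite ge_min lexx orbT.
  rewrite /d; lra.
pose eps := d ^+ 3 / 6.
have eps0 : 0 < eps by rewrite divr_gt0 ?exprn_gt0.
have epsd : eps <= d.
  have d2 : d ^+ 2 <= d by rewrite expr2 ler_piMl // ltW.
  have : d ^+ 3 <= d ^+ 2 by rewrite exprS ler_piMl // sqr_ge0.
  rewrite /eps; lra.
have [M HM] := regularity eps0.
(* At most M cells of fewer than s * n vertices cover at most d * n vertices. *)
pose s := d / M.+1%:R.
have s0 : 0 < s by rewrite divr_gt0.
exists (d ^+ 3 / 2 * s ^+ 3); first by rewrite mulr_gt0 ?divr_gt0 ?exprn_gt0.
move=> V e few.
have [x y|I [c [phi [IM irr]]]] := HM V (fun x y => (e x y)%:R).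
  by rewrite ler0n lern1 leq_b1.
pose reg x y := regular eps (fun x y => (e x y)%:R) c phi (c x) (c y).
pose small x := weight c (c x) < s * #|V|%:R.
exists (fun x y => [|| ~~ reg x y, e x y && reg x y && (phi (c x) (c y) < d), small x | small y]).
split.
  have hsmall : \sum_x (small x)%:R <= d * #|V|%:R.
    apply: le_trans (small_cells_le _ _) _; first by rewrite mulr_ge0 // ltW.
    rewrite mulrA ler_wpM2r // /s mulrCA ler_piMr ?(ltW d0) //.
    by rewrite ler_pdivrMr // mul1r ler_nat (leq_trans IM).
  have hsp := @sparse_edges_le R V e I c phi eps d (ltW (addr_gt0 d0 eps0)).
  have hir := @irregular_edges R V e I c phi eps.
  apply: (@le_trans _ _ (\sum_x \sum_y ((~~ reg x y)%:R +
     (e x y && reg x y && (phi (c x) (c y) < d))%:R + (small x)%:R + (small y)%:R))).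
    apply: ler_sum => x _; apply: ler_sum => y _; rewrite -!natrD ler_nat.
    by case: (~~ _); case: (_ && _); case: (small x); case: (small y).
  under eq_bigr => x _ do rewrite 3!big_split /=.
  rewrite 3!big_split /=.
  have V0 : 0 <= #|V|%:R ^+ 2 :> R by rewrite sqr_ge0.
  have e1 : eps * #|V|%:R ^+ 2 <= d * #|V|%:R ^+ 2 by rewrite ler_wpM2r.
  have e2 : \sum_(x : V) \sum_(y : V) (small y)%:R <= d * #|V|%:R ^+ 2.
    by rewrite sumr_const -[leLHS]mulr_natr expr2 mulrA ler_wpM2r.
  have e2' : \sum_(x : V) \sum_(y : V) (small x)%:R <= d * #|V|%:R ^+ 2.
    by rewrite exchange_big.
  have e3 : 5 * d * #|V|%:R ^+ 2 <= delta * #|V|%:R ^+ 2 by rewrite ler_wpM2r.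
  have e4 : (d + eps) * #|V|%:R ^+ 2 <= 2 * d * #|V|%:R ^+ 2 by rewrite ler_wpM2r //; lra.
  move: hsp irr; rewrite -hir -/reg; lra.
move=> x y z exy eyz exz; apply: contraTT few.
rewrite !negb_or !negbK exy eyz exz /= -!leNgt.
case/and3P => /and4P[rxy pxy sx sy] /and4P[ryz pyz _ sz] /and4P[rxz pxz _ _].
move: pxy pyz pxz; rewrite rxy ryz rxz /= -!leNgt => pxy pyz pxz.
apply: le_trans (triangles_in_le _ _ _ _ _).
apply: le_trans (triangle_counting d0 d1 (erefl _) rxy ryz rxz pxy pyz pxz).
rewrite -[leLHS]mulrA ler_wpM2l ?divr_ge0 ?exprn_ge0 ?(ltW d0) // -exprMn exprS expr2 mulrA.
have sV : 0 <= s * #|V|%:R by rewrite mulr_ge0 // ltW.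
by apply: ler_pM => //; [apply: mulr_ge0 | apply: ler_pM].
Qed.

(** * From triangles to K_{1,2,2} *)

Section Counts.
Context {V : finType} (e : rel V).

Definition triangle_count : nat :=
  (\sum_x \sum_y \sum_z [&& e x y, e y z & e x z])%N.

(** [x] is the apex; [y], [y'] and [z], [z'] are the two doubled parts. Coincidences within a part
    are allowed, as for homomorphisms. *)
Definition K122_count : nat :=
  (\sum_x \sum_y \sum_y' \sum_z \sum_z'
    [&& e x y, e x y', e x z, e x z', e y z, e y z', e y' z & e y' z'])%N.

End Counts.

Lemma num_hom_sum (H G : sgraph) : num_hom H G = (\sum_(f : {ffun H -> G}) is_hom f)%N.
Proof.
rewrite /num_hom -sum1_card big_mkcond; apply: eq_bigr => f _.
by rewrite inE; case: (is_hom f).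
Qed.

Lemma num_hom_triangle (G : sgraph) :
  num_hom (complete_graph 3) G = triangle_count (@adj G).
Proof.
pose h (p : G * G * G) : {ffun complete_graph 3 -> G} :=
  [ffun i : 'I_3 => nth p.1.1 [:: p.1.1; p.1.2; p.2] i].
pose i0 : 'I_3 := @Ordinal 3 0 isT; pose i1 : 'I_3 := @Ordinal 3 1 isT.
pose i2 : 'I_3 := @Ordinal 3 2 isT.
have hbij : bijective h.
  exists (fun f : {ffun _ -> G} => (f i0, f i1, f i2)) => [[[x y] z]|f]; first by rewrite !ffunE.
  apply/ffunP => i; rewrite ffunE.
  by case: i => [[|[|[|]]]] //= hi; congr (f _); apply: val_inj.
rewrite num_hom_sum (reindex h (onW_bij _ hbij)) /triangle_count.
rewrite pair_bigA pair_bigA /=; apply: eq_bigr => -[[x y] z] _ /=; congr (nat_of_bool _).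
apply/idP/idP => [hom|/and3P[exy eyz exz]].
  have hh (i j : 'I_3) : i != j -> adj (h (x, y, z) i) (h (x, y, z) j).
    by move=> ij; have /forallP/(_ i)/forallP/(_ j)/implyP := hom; apply.
  by have := (hh i0 i1 isT, hh i1 i2 isT, hh i0 i2 isT); rewrite !ffunE /= => -[[-> ->] ->].
apply/forallP => i; apply/forallP => j; apply/implyP; rewrite !ffunE /= /complete_adj.
by case: i => [[|[|[|]]]] //= hi; case: j => [[|[|[|]]]] //= hj _; rewrite // adj_sym.
Qed.

Lemma num_hom_K122 (G : sgraph) :
  num_hom (complete_tripartite 1 2 2) G = K122_count (@adj G).
Proof.
pose i0 : 'I_2 := @Ordinal 2 0 isT; pose i1 : 'I_2 := @Ordinal 2 1 isT.
pose h (p : G * G * G * G * G) : {ffun complete_tripartite 1 2 2 -> G} :=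
  [ffun v : 'I_1 + 'I_2 + 'I_2 => match v with
   | inl (inl _) => p.1.1.1.1
   | inl (inr i) => if i == i0 then p.1.1.1.2 else p.1.1.2
   | inr i => if i == i0 then p.1.2 else p.2 end].
have hbij : bijective h.
  exists (fun f : {ffun _ -> G} => (f (inl (inl ord0)), f (inl (inr i0)), f (inl (inr i1)),
                    f (inr i0), f (inr i1))) => [[[[[x y] y'] z] z']|f].
    by rewrite !ffunE.
  have ord2 (i : 'I_2) : i != i0 -> i = i1.
    by case: i => [[|[|]]] //= hi _; apply: val_inj.
  apply/ffunP => -[[i|i]|i]; rewrite ffunE /=.
  - by rewrite (ord1 i).
  - by case: eqVneq => [->//|/ord2 ->].
  - by case: eqVneq => [->//|/ord2 ->].
rewrite num_hom_sum (reindex h (onW_bij _ hbij)) /K122_count.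
rewrite !pair_bigA /=; apply: eq_bigr => -[[[[x y] y'] z] z'] _ /=; congr (nat_of_bool _).
apply/idP/idP => [hom|].
  have hh (i j : 'I_1 + 'I_2 + 'I_2) : tripart i != tripart j ->
      adj (h (x, y, y', z, z') i) (h (x, y, y', z, z') j).
    by move=> ij; have /forallP/(_ i)/forallP/(_ j)/implyP := hom; apply.
  have := (hh (inl (inl ord0)) (inl (inr i0)) isT, hh (inl (inl ord0)) (inl (inr i1)) isT,
           hh (inl (inl ord0)) (inr i0) isT, hh (inl (inl ord0)) (inr i1) isT).
  rewrite !ffunE /= => -[[[-> ->] ->] ->] /=.
  have := (hh (inl (inr i0)) (inr i0) isT, hh (inl (inr i0)) (inr i1) isT,
           hh (inl (inr i1)) (inr i0) isT, hh (inl (inr i1)) (inr i1) isT).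
  by rewrite !ffunE /= => -[[[-> ->] ->] ->].
case/and5P => exy exy' exz exz' /and4P[eyz eyz' ey'z ey'z'].
apply/forallP => i; apply/forallP => j; apply/implyP; rewrite !ffunE /= /tripartite_adj.
by case: i => [[i|i]|i]; case: j => [[j|j]|j] //= _; do ?case: ifP => _; rewrite // adj_sym.
Qed.

(** Lagrange's identity: the squares of all 2 x 2 minors sum to twice the gap between the two
    sides. *)
Lemma cauchy_schwarz_sum (R : realType) (I : finType) (a b : I -> R) :
  (\sum_i a i * b i) ^+ 2 <= (\sum_i a i ^+ 2) * (\sum_i b i ^+ 2).
Proof.
have : 0 <= \sum_i \sum_j (a i * b j - a j * b i) ^+ 2.
  by apply: sumr_ge0 => i _; apply: sumr_ge0 => j _; apply: sqr_ge0.
have -> : \sum_i \sum_j (a i * b j - a j * b i) ^+ 2 =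
    2 * ((\sum_i a i ^+ 2) * (\sum_i b i ^+ 2) - (\sum_i a i * b i) ^+ 2).
  set A := \sum_i a i ^+ 2; set B := \sum_i b i ^+ 2.
  have e1 : A * B = \sum_i \sum_j a i ^+ 2 * b j ^+ 2 by rewrite big_distrlr.
  have e2 : A * B = \sum_i \sum_j a j ^+ 2 * b i ^+ 2 by rewrite e1 exchange_big.
  rewrite mulrBr mulr_natl mulr2n {1}e1 e2 expr2 big_distrlr mulr_sumr -big_split -sumrB /=.
  apply: eq_bigr => i _; rewrite mulr_sumr -big_split -sumrB /=.
  by apply: eq_bigr => j _; ring.
by rewrite pmulr_rge0 ?ltr0n // subr_ge0.
Qed.

Lemma sqr_sum_le_card (R : realType) (I : finType) (a : I -> R) :
  (\sum_i a i) ^+ 2 <= #|I|%:R * \sum_i a i ^+ 2.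
Proof.
have := cauchy_schwarz_sum (fun=> 1) a.
under eq_bigr => i _ do rewrite mul1r; move/le_trans; apply.
by under eq_bigr => i _ do rewrite expr1n; rewrite sumr_const.
Qed.

(** * Two applications of Cauchy-Schwarz *)

Section LowerBound.
Context {R : realType} {V : finType} (e : rel V) (esym : symmetric e).

Let t x y : R := \sum_z [&& e x y, e y z & e x z]%:R.

(** The triangle indicator is invariant under permuting x, y, z. Hence the right-hand side sums,
    over all triangles, the number of pairs among xy, yz, xz in [S], which is at least one. *)
Lemma triangles_on_edges (S : rel V) :
  (forall x y z, e x y -> e y z -> e x z -> [|| S x y, S y z | S x z]) ->
  (triangle_count e)%:R <= 3 * \sum_x \sum_y (S x y)%:R * t x y.
Proof.
move=> hit; set E := \sum_x _.
pose tr x y z : R := [&& e x y, e y z & e x z]%:R.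
have E1 : E = \sum_x \sum_y \sum_z (S x y)%:R * tr x y z.
  by apply: eq_bigr => x _; apply: eq_bigr => y _; rewrite mulr_sumr.
have E2 : E = \sum_x \sum_y \sum_z (S y z)%:R * tr x y z.
  rewrite E1 [RHS]exchange_big; apply: eq_bigr => y _.
  rewrite [RHS]exchange_big; apply: eq_bigr => z _; apply: eq_bigr => x _.
  by rewrite /tr (esym x y) (esym x z); case: (e y x); case: (e z x); case: (e y z).
have E3 : E = \sum_x \sum_y \sum_z (S x z)%:R * tr x y z.
  rewrite E1; apply: eq_bigr => x _; rewrite [RHS]exchange_big.
  apply: eq_bigr => z _; apply: eq_bigr => y _.
  by rewrite /tr (esym y z); case: (e x y); case: (e z y); case: (e x z).
have -> : 3 * E = E + E + E by ring.
rewrite [X in X + _ + _]E1 [X in _ + X + _]E2 [X in _ + _ + X]E3 -!big_split /= natr_sum.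
apply: ler_sum => x _.
rewrite -!big_split /= natr_sum; apply: ler_sum => y _.
rewrite -!big_split /= natr_sum; apply: ler_sum => z _.
rewrite /tr; have [/and3P[exy eyz exz]|_] := boolP [&& e x y, e y z & e x z];
  last by rewrite !mulr0 !addr0.
rewrite !mulr1 -!natrD ler_nat; have := hit x y z exy eyz exz.
by case: (S x y); case: (S y z); case: (S x z).
Qed.

(** The inner sum counts copies of K_{1,1,2} on x, y, z, z'. Grouped by the n ^ 3 triples (x, z,
    z'), it adds up numbers of common neighbours y; Cauchy-Schwarz squares these numbers, and a pair
    (y, y') over one triple is a K_{1,2,2}. *)
Lemma codegree_bound :
  (\sum_x \sum_y t x y ^+ 2) ^+ 2 <= #|V|%:R ^+ 3 * (K122_count e)%:R.
Proof.
pose q (p : V * V * V) y : R :=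
  [&& e p.1.1 y, e p.1.1 p.1.2, e p.1.1 p.2, e y p.1.2 & e y p.2]%:R.
have -> : \sum_x \sum_y t x y ^+ 2 = \sum_p \sum_y q p y.
  rewrite -(pair_bigA _ (fun p z' => \sum_y q (p, z') y)) /=.
  rewrite -(pair_bigA _ (fun x z => \sum_z' \sum_y q (x, z, z') y)) /=.
  apply: eq_bigr => x _.
  transitivity (\sum_y \sum_z \sum_z' q (x, z, z') y).
    apply: eq_bigr => y _; rewrite /t expr2 big_distrlr /=.
    apply: eq_bigr => z _; apply: eq_bigr => z' _; rewrite /q -natrM mulnb /=.
    by case: (e x y); case: (e y z); case: (e x z); case: (e y z'); case: (e x z').
  by rewrite exchange_big; apply: eq_bigr => z _; rewrite exchange_big.
apply: le_trans (sqr_sum_le_card _) _; rewrite !card_prod !natrM -expr2 -exprSr.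
rewrite ler_wpM2l ?exprn_ge0 ?ler0n // le_eqVlt; apply/orP; left; apply/eqP.
rewrite -(pair_bigA _ (fun p z' => (\sum_y q (p, z') y) ^+ 2)) /=.
rewrite -(pair_bigA _ (fun x z => \sum_z' (\sum_y q (x, z, z') y) ^+ 2)) /=.
rewrite natr_sum; apply: eq_bigr => x _.
transitivity (\sum_z \sum_z' \sum_y \sum_y' q (x, z, z') y * q (x, z, z') y').
  by apply: eq_bigr => z _; apply: eq_bigr => z' _; rewrite expr2 big_distrlr.
transitivity (\sum_y \sum_y' \sum_z \sum_z' q (x, z, z') y * q (x, z, z') y').
  under eq_bigr => z _ do rewrite exchange_big /=.
  rewrite exchange_big /=; apply: eq_bigr => y _.
  under eq_bigr => z _ do rewrite exchange_big /=.
  by rewrite exchange_big.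
rewrite natr_sum; apply: eq_bigr => y _; rewrite natr_sum; apply: eq_bigr => y' _.
rewrite natr_sum; apply: eq_bigr => z _; rewrite natr_sum; apply: eq_bigr => z' _.
rewrite /q -natrM mulnb /=; congr (_%:R); congr nat_of_bool.
by case: (e x y); case: (e x y'); case: (e x z); case: (e x z');
   case: (e y z); case: (e y z'); case: (e y' z); case: (e y' z').
Qed.

Lemma triangle_pow4_le (S : rel V) (delta : R) :
  \sum_x \sum_y (S x y)%:R <= delta * #|V|%:R ^+ 2 ->
  (forall x y z, e x y -> e y z -> e x z -> [|| S x y, S y z | S x z]) ->
  (triangle_count e)%:R ^+ 4 <=
    81 * delta ^+ 2 * #|V|%:R ^+ 7 * (K122_count e)%:R.
Proof.
move=> Sle hit; set D := \sum_x \sum_y t x y ^+ 2.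
(* Cauchy-Schwarz with the weights [S], which equal their squares, being 0 or 1. *)
have h2 : (triangle_count e)%:R ^+ 2 <= 9 * (delta * #|V|%:R ^+ 2) * D.
  have h : (triangle_count e)%:R ^+ 2 <= (3 * \sum_x \sum_y (S x y)%:R * t x y) ^+ 2.
    rewrite ler_sqr ?nnegrE ?triangles_on_edges ?ler0n //.
    exact: le_trans (ler0n _ _) (triangles_on_edges hit).
  apply: le_trans h _; rewrite exprMn.
  have -> : 9 * (delta * #|V|%:R ^+ 2) * D = 3 ^+ 2 * (delta * #|V|%:R ^+ 2 * D) by ring.
  rewrite ler_wpM2l ?sqr_ge0 //.
  rewrite pair_bigA /=; apply: le_trans (cauchy_schwarz_sum _ _) _.
  rewrite -(pair_bigA _ (fun x y => (S x y)%:R ^+ 2)) -(pair_bigA _ (fun x y => t x y ^+ 2)) /=.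
  rewrite -/D ler_wpM2r //.
    by apply: sumr_ge0 => x _; apply: sumr_ge0 => y _; apply: sqr_ge0.
  apply: le_trans Sle; apply: ler_sum => x _; apply: ler_sum => y _.
  by case: (S x y); rewrite ?expr1n ?expr0n.
apply: (@le_trans _ _ ((9 * (delta * #|V|%:R ^+ 2) * D) ^+ 2)).
  by rewrite (_ : 4 = 2 * 2)%N // exprM ler_sqr ?nnegrE ?exprn_ge0 ?ler0n //
    (le_trans _ h2) ?sqr_ge0.
have -> : (9 * (delta * #|V|%:R ^+ 2) * D) ^+ 2 = 81 * delta ^+ 2 * #|V|%:R ^+ 4 * D ^+ 2 by ring.
have -> : 81 * delta ^+ 2 * #|V|%:R ^+ 7 * (K122_count e)%:R =
  81 * delta ^+ 2 * #|V|%:R ^+ 4 * (#|V|%:R ^+ 3 * (K122_count e)%:R) by ring.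
rewrite ler_wpM2l ?codegree_bound //.
by rewrite mulr_ge0 ?exprn_ge0 // mulr_ge0 ?sqr_ge0.
Qed.

End LowerBound.

(** * The sphere graph and its blowups *)

Section SparseGraphs.
Local Open Scope nat_scope.

Lemma sum_bool_card (T : finType) (P : pred T) : \sum_p P p = #|P|.
Proof.
rewrite -sum1_card [RHS]big_mkcond; apply: eq_bigr => p _.
by rewrite unfold_in; case: (P p).
Qed.

(** The pair (x, y) determines everything else: the edge xy admits only one z, so z = z', and then
    the edge xz admits only y, so y' = y. *)
Lemma K122_count_le (V : finType) (e : rel V) : symmetric e ->
  (forall x y z z', e x y -> e x z -> e y z -> e x z' -> e y z' -> z = z') ->
  K122_count e <= #|V| ^ 2.
Proof.
move=> esym uniq_tri.
have -> : #|V| ^ 2 = \sum_(x : V) \sum_(y : V) 1.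
  by rewrite !sum_nat_const muln1 -mulnn.
apply: leq_sum => x _; apply: leq_sum => y _.
rewrite !pair_bigA /= sum_bool_card; apply/card_le1_eqP.
move=> [[y1 z1] z1'] [[y2 z2] z2']; rewrite !unfold_in /=.
have key y' z z' : [&& e x y, e x y', e x z, e x z', e y z, e y z', e y' z & e y' z'] ->
    y' = y /\ z = z'.
  case/and5P => exy exy' exz exz' /and4P[eyz eyz' ey'z ey'z']; split.
    by apply: (uniq_tri x z); rewrite // esym.
  exact: (uniq_tri x y).
move=> h1 h2; have [-> e1] := key _ _ _ h1; have [-> e2] := key _ _ _ h2.
rewrite -e1 -e2; suff -> : z1 = z2 by [].
move: h1 h2 => /and5P[exy _ exz _ /and4P[eyz _ _ _]] /and5P[_ _ exw _ /and4P[eyw _ _ _]].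
exact: (uniq_tri x y).
Qed.

(** * Spheres without midpoints and the graph of their directions *)

Section SphereGraph.
Variables (k d r : nat).

Definition sphere : {set {ffun 'I_k -> 'I_d}} :=
  [set s : {ffun 'I_k -> 'I_d} | \sum_i s i ^ 2 == r]%SET.

(** Strict convexity through the parallelogram law: with 2p = q + m and equal norms, |q - m| ^ 2 =
    2|q| ^ 2 + 2|m| ^ 2 - 4|p| ^ 2 = 0. *)
Lemma sphere_midpoint p q m : p \in sphere -> q \in sphere -> m \in sphere ->
  (forall i : 'I_k, q i + m i = 2 * p i) -> p = q /\ p = m.
Proof.
rewrite !inE => /eqP pr /eqP qr /eqP mr mid.
(* With truncated subtraction this sum is the absolute difference, as one of the summands
   vanishes. *)
pose D i := (q i - m i) + (m i - q i).
have DE : \sum_i D i ^ 2 + 4 * \sum_i p i ^ 2 = 2 * \sum_i q i ^ 2 + 2 * \sum_i m i ^ 2.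
  rewrite !big_distrr -!big_split /=; apply: eq_bigr => i _; have := mid i; rewrite /D -!mulnn.
  move: (p i : nat) (q i : nat) (m i : nat) => a b c abc; nia.
have : \sum_i D i ^ 2 = 0.
  by move: DE; rewrite pr qr mr; lia.
move/eqP; rewrite sum_nat_eq0 => /forallP D0.
by split; apply/ffunP => i; apply: val_inj => /=;
  have := D0 i; rewrite /= /D expn_eq0 andbT addn_eq0 !subn_eq0; have := mid i;
  move: (p i : nat) (q i : nat) (m i : nat) => a b c abc /andP[]; lia.
Qed.

(* The vertex [(a, x)] stands for the point [x] of the [a]-th colour class; two
   points of distinct classes are adjacent when they lie on a common line
   [x + a * s] with direction [s] on the sphere. *)
Definition sphere_vertex := ('I_3 * {ffun 'I_k -> 'I_(3 * d)})%type.

(** Equality of the starting points [u.2 - u.1 * s] and [v.2 - v.1 * s], with both subtractions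
    moved across so as to stay in the naturals. *)
Definition on_line (s : {ffun 'I_k -> 'I_d}) (u v : sphere_vertex) : bool :=
  [forall i, v.2 i + u.1 * s i == u.2 i + v.1 * s i].

Definition sphere_adj : rel sphere_vertex :=
  fun u v => (u.1 != v.1) && [exists s in sphere, on_line s u v].

Lemma sphere_adj_sym : symmetric sphere_adj.
Proof.
move=> u v; rewrite /sphere_adj eq_sym; congr (_ && _).
apply: eq_existsb => s; congr (_ && _); apply: eq_forallb => i; exact: eq_sym.
Qed.

Lemma sphere_adj_irrefl : irreflexive sphere_adj.
Proof. by move=> u; rewrite /sphere_adj eqxx. Qed.

Definition sphere_graph := SGraph sphere_adj_sym sphere_adj_irrefl.

(** For classes a, b, c, going around the triangle gives (b - a) s + (c - b) s' = (c - a) s''. As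
    {a, b, c} = {0, 1, 2}, one difference is 2 up to sign and the others 1, so one direction is the
    midpoint of the other two. *)
Lemma sphere_triangle s s' s'' (u v w : sphere_vertex) :
  s \in sphere -> s' \in sphere -> s'' \in sphere ->
  u.1 != v.1 -> v.1 != w.1 -> u.1 != w.1 ->
  on_line s u v -> on_line s' v w -> on_line s'' u w -> s = s''.
Proof.
move=> Ss Ss' Ss''; rewrite -!val_eqE /= => uv vw uw /forallP h /forallP h' /forallP h''.
case: u v w uv vw uw h h' h'' => -[a ha] x [[b hb] y] [[c hc] z] /= ab bc ac h h' h''.
have E (i : 'I_k) : b * s i + c * s' i + a * s'' i = a * s i + b * s' i + c * s'' i.
  have := h i; have := h' i; have := h'' i => /=.
  move: (s i : nat) (s' i : nat) (s'' i : nat) (x i : nat) (y i : nat) (z i : nat) => *; lia.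
case: a ha ab ac h h'' E => [|[|[|]]] //= _; case: b hb bc h' => [|[|[|]]] //= _;
  case: c hc => [|[|[|]]] //= _ _ _ _ _ _ _ E.
- by have [] := @sphere_midpoint s'' s s' Ss'' Ss Ss'
    (fun i => ltac:(have := E i; move: (s i : nat) (s' i : nat) (s'' i : nat) => *; lia)).
- by have [] := @sphere_midpoint s s' s'' Ss Ss' Ss''
    (fun i => ltac:(have := E i; move: (s i : nat) (s' i : nat) (s'' i : nat) => *; lia)).
- by have [<- ->] := @sphere_midpoint s' s s'' Ss' Ss Ss''
    (fun i => ltac:(have := E i; move: (s i : nat) (s' i : nat) (s'' i : nat) => *; lia)).
- by have [<- ->] := @sphere_midpoint s' s s'' Ss' Ss Ss''
    (fun i => ltac:(have := E i; move: (s i : nat) (s' i : nat) (s'' i : nat) => *; lia)).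
- by have [] := @sphere_midpoint s s' s'' Ss Ss' Ss''
    (fun i => ltac:(have := E i; move: (s i : nat) (s' i : nat) (s'' i : nat) => *; lia)).
- by have [] := @sphere_midpoint s'' s s' Ss'' Ss Ss'
    (fun i => ltac:(have := E i; move: (s i : nat) (s' i : nat) (s'' i : nat) => *; lia)).
Qed.

(** Both triangles inherit the direction of the edge uv, so w and w' lie on the same line through u.
    Both are in the only class left by u and v, hence at the same point of that line. *)
Lemma sphere_unique_triangle u v w w' : sphere_adj u v -> sphere_adj u w ->
  sphere_adj v w -> sphere_adj u w' -> sphere_adj v w' -> w = w'.
Proof.
case/andP=> uv /exists_inP[s Ss luv].
case/andP=> uw /exists_inP[s1 S1 luw]; case/andP=> vw /exists_inP[s2 S2 lvw].
case/andP=> uw' /exists_inP[s3 S3 luw']; case/andP=> vw' /exists_inP[s4 S4 lvw'].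
have E1 : s = s1 := sphere_triangle Ss S2 S1 uv vw uw luv lvw luw.
have E3 : s = s3 := sphere_triangle Ss S4 S3 uv vw' uw' luv lvw' luw'.
move: luw luw'; rewrite -E1 -E3 => /forallP luw /forallP luw'.
have ww' : w.1 = w'.1.
  apply: val_inj; move: uv uw vw uw' vw'; rewrite -!val_eqE /=.
  have := ltn_ord u.1; have := ltn_ord v.1; have := ltn_ord w.1; have := ltn_ord w'.1; lia.
case: w w' ww' luw luw' {lvw lvw' uw uw' vw vw'} => [c z] [c' z'] /= <- h h'.
congr (_, _); apply/ffunP => i; apply: val_inj => /=.
have := h i; have := h' i => /=; lia.
Qed.

(** Each start x in the small box and each direction s give a triangle x, x + s, x + 2s, from which
    x and s can be recovered. Side 3 * d for the vertex box leaves room for x + 2s. *)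
Lemma sphere_triangle_count :
  d ^ k * #|sphere| <= triangle_count sphere_adj.
Proof.
have lt3 (a : 'I_3) (x s : 'I_d) : x + a * s < 3 * d.
  have := ltn_ord a; have := ltn_ord x; have := ltn_ord s.
  move: (a : nat) (x : nat) (s : nat) => *; nia.
pose pt (x s : {ffun 'I_k -> 'I_d}) (a : 'I_3) : sphere_vertex :=
  (a, [ffun i => Ordinal (lt3 a (x i) (s i))]).
pose i0 : 'I_3 := @Ordinal 3 0 isT; pose i1 : 'I_3 := @Ordinal 3 1 isT.
pose i2 : 'I_3 := @Ordinal 3 2 isT.
have ptadj x s a b : s \in sphere -> a != b -> sphere_adj (pt x s a) (pt x s b).
  move=> Ss ab; rewrite /sphere_adj ab /=; apply/exists_inP; exists s => //.
  by apply/forallP => i; rewrite !ffunE /= addnAC.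
pose f p := (pt p.1 p.2 i0, pt p.1 p.2 i1, pt p.1 p.2 i2).
have finj : injective f.
  move=> [x s] [x' s'] /pair_equal_spec[/pair_equal_spec[/pair_equal_spec[_ /ffunP h0]
     /pair_equal_spec[_ /ffunP h1]] _].
  have E0 i : x i = x' i.
    by apply: val_inj; have := congr1 val (h0 i); rewrite !ffunE /= !mul0n !addn0.
  have E1 i : s i = s' i.
    by apply: val_inj; have := congr1 val (h1 i); rewrite !ffunE /= E0 !mul1n => /addnI.
  by congr (_, _); apply/ffunP.
rewrite /triangle_count !pair_bigA /= sum_bool_card.
have -> : d ^ k * #|sphere| = #|f @: finset.setX finset.setT sphere|.
  by rewrite card_imset // cardsX cardsT card_ffun !card_ord.
apply: subset_leq_card; apply/fintype.subsetP => _ /imsetP[[x s] + ->].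
rewrite !inE /= => Ss; rewrite unfold_in /=.
by rewrite !ptadj // inE.
Qed.

End SphereGraph.

(** Pigeonhole: the d ^ k points have squared norms among k * d ^ 2 + 1 values. *)
Lemma large_sphere k d : exists r, d ^ k <= #|sphere k d r| * (k * d ^ 2).+1.
Proof.
pose K := (k * d ^ 2).+1; apply: contrapT => /forallNP small.
have lt r : #|sphere k d r| * K < d ^ k by rewrite ltnNge; apply/negP; exact: small.
have sumS : \sum_(r < K) #|sphere k d r| = d ^ k.
  have sumlt (s : {ffun 'I_k -> 'I_d}) : \sum_i s i ^ 2 < K.
    rewrite ltnS -[X in X * _](card_ord k) -sum_nat_const; apply: leq_sum => i _.
    by rewrite leq_exp2r // ltnW.
  have -> : d ^ k = #|{ffun 'I_k -> 'I_d}| by rewrite card_ffun !card_ord.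
  rewrite -sum1_card.
  rewrite (partition_big (fun s => Ordinal (sumlt s)) predT) //=.
  apply: eq_bigr => r _; rewrite -sum1_card; apply: eq_bigl => s.
  by rewrite inE -val_eqE.
have : \sum_(r < K) #|sphere k d r| * K < \sum_(r < K) d ^ k.
  rewrite !big_ord_recl /= -addSn leq_add ?lt //.
  by apply: leq_sum => i _; exact: ltnW.
by rewrite -big_distrl /= sumS sum_nat_const card_ord mulnC ltnn.
Qed.

Lemma sparse_linear_graph k d : exists G : sgraph,
  [/\ #|G| = 3 * (3 * d) ^ k,
      d ^ (2 * k) <= triangle_count (@adj G) * (k * d ^ 2).+1
    & K122_count (@adj G) <= #|G| ^ 2].
Proof.
have [r hr] := large_sphere k d; exists (sphere_graph k d r); split.
- by rewrite /= card_prod card_ffun !card_ord.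
- rewrite mul2n -addnn expnD; apply: (@leq_trans (d ^ k * #|sphere k d r| * (k * d ^ 2).+1)).
    by rewrite -mulnA leq_mul2l hr orbT.
  by rewrite leq_mul2r sphere_triangle_count orbT.
- apply: K122_count_le; first exact: sphere_adj_sym.
  exact: sphere_unique_triangle.
Qed.

(** * Blowups with isolated vertices added *)

Section Blowup.
Variables (G : sgraph) (t s : nat).

Definition blowup_vertex := (G * 'I_t + 'I_s)%type.

Definition base (v : blowup_vertex) : option G :=
  if v is inl p then Some p.1 else None.

Definition base_adj (u v : option G) : bool :=
  if (u, v) is (Some x, Some y) then adj x y else false.

Definition blowup_adj : rel blowup_vertex := fun u v => base_adj (base u) (base v).

Lemma blowup_adj_sym : symmetric blowup_adj.
Proof. by move=> [[x i]|i] [[y j]|j] //; apply: adj_sym. Qed.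

Lemma blowup_adj_irrefl : irreflexive blowup_adj.
Proof. by move=> [[x i]|i] //; apply: adj_irrefl. Qed.

Definition blowup := SGraph blowup_adj_sym blowup_adj_irrefl.

Lemma card_blowup : #|blowup| = #|G| * t + s.
Proof. by rewrite card_sum card_prod !card_ord. Qed.

(** Peels one variable off a homomorphism count: isolated vertices contribute nothing and each
    vertex of [G] has [t] copies. Three uses give t ^ 3 for triangles, five give t ^ 5 for
    K_{1,2,2}. *)
Lemma sum_blowup (F : option G -> nat) : F None = 0 ->
  \sum_(v : blowup) F (base v) = t * \sum_x F (Some x).
Proof.
move=> F0; rewrite big_sumType /= [X in _ + X]big1 ?addn0 //.
rewrite -(pair_bigA _ (fun x (_ : 'I_t) => F (Some x))) /= big_distrr /=.
by apply: eq_bigr => x _; rewrite sum_nat_const card_ord.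
Qed.

Lemma triangle_count_blowup :
  triangle_count (@adj blowup) = t ^ 3 * triangle_count (@adj G).
Proof.
rewrite /triangle_count /= /blowup_adj.
rewrite (sum_blowup (F := fun x => \sum_(y : blowup) \sum_(z : blowup)
  [&& base_adj x (base y), base_adj (base y) (base z) & base_adj x (base z)])); last first.
  by rewrite big1 // => y _; rewrite big1.
rewrite expnS -mulnA; congr (_ * _); rewrite big_distrr; apply: eq_bigr => x _ /=.
rewrite (sum_blowup (F := fun y => \sum_(z : blowup)
  [&& base_adj (Some x) y, base_adj y (base z) & base_adj (Some x) (base z)])); last first.
  by rewrite big1.
rewrite expnS -mulnA; congr (_ * _); rewrite big_distrr; apply: eq_bigr => y _ /=.
rewrite (sum_blowup (F := fun z =>
  [&& base_adj (Some x) (Some y), base_adj (Some y) z & base_adj (Some x) z] : nat)) ?expn1 //.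
by rewrite /= andbF.
Qed.

Lemma K122_count_blowup :
  K122_count (@adj blowup) = t ^ 5 * K122_count (@adj G).
Proof.
rewrite /K122_count /= /blowup_adj.
pose F x y y' z z' : nat := [&& base_adj x y, base_adj x y', base_adj x z, base_adj x z',
  base_adj y z, base_adj y z', base_adj y' z & base_adj y' z'].
rewrite (sum_blowup (F := fun x => \sum_(y : blowup) \sum_(y' : blowup) \sum_(z : blowup)
  \sum_(z' : blowup) F x (base y) (base y') (base z) (base z'))); last first.
  by rewrite big1 // => y _; rewrite big1 // => y' _; rewrite big1 // => z _; rewrite big1.
rewrite expnS -mulnA; congr (_ * _); rewrite big_distrr; apply: eq_bigr => x _ /=.
rewrite (sum_blowup (F := fun y => \sum_(y' : blowup) \sum_(z : blowup)
  \sum_(z' : blowup) F (Some x) y (base y') (base z) (base z'))); last first.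
  by rewrite big1 // => y' _; rewrite big1 // => z _; rewrite big1.
rewrite expnS -mulnA; congr (_ * _); rewrite big_distrr; apply: eq_bigr => y _ /=.
rewrite (sum_blowup (F := fun y' => \sum_(z : blowup)
  \sum_(z' : blowup) F (Some x) (Some y) y' (base z) (base z'))); last first.
  by rewrite big1 // => z _; rewrite big1 // => z' _; rewrite /F /= !andbF.
rewrite expnS -mulnA; congr (_ * _); rewrite big_distrr; apply: eq_bigr => y' _ /=.
rewrite (sum_blowup (F := fun z =>
  \sum_(z' : blowup) F (Some x) (Some y) (Some y') z (base z'))); last first.
  by rewrite big1 // => z' _; rewrite /F /= !andbF.
rewrite expnS -mulnA; congr (_ * _); rewrite big_distrr; apply: eq_bigr => z _ /=.
rewrite (sum_blowup (F := fun z' => F (Some x) (Some y) (Some y') (Some z) z')) ?expn1 //.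
by rewrite /F /= !andbF.
Qed.

End Blowup.
End SparseGraphs.

(** * Asymptotic densities *)

Lemma density_triangle (R : realType) (G : sgraph) :
  density R (complete_graph 3) G = (triangle_count (@adj G))%:R / #|G|%:R ^+ 3.
Proof. by rewrite /density num_hom_triangle /= card_ord. Qed.

Lemma density_K122 (R : realType) (G : sgraph) :
  density R (complete_tripartite 1 2 2) G = (K122_count (@adj G))%:R / #|G|%:R ^+ 5.
Proof. by rewrite /density num_hom_K122 /= !card_sum !card_ord. Qed.

Lemma density_ge0 (R : realType) (H G : sgraph) : 0 <= density R H G.
Proof. by rewrite divr_ge0 ?exprn_ge0. Qed.

Definition attainable (R : realType) (B : sgraph) (gamma : R) : set R :=
  [set beta : R | exists G : nat -> sgraph,
    [/\ #|G i| @[i --> \oo] --> \oo,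
        density R (complete_graph 3) (G i) @[i --> \oo] --> gamma
      & density R B (G i) @[i --> \oo] --> beta]].

Lemma attainable_ge0 (R : realType) (B : sgraph) (gamma : R) :
  lbound (attainable B gamma) 0.
Proof.
move=> beta [G [_ _ Gbeta]].
apply: (ler_cvg_to (cvg_cst 0) Gbeta); near=> i; exact: density_ge0.
Unshelve. all: by end_near. Qed.

Lemma min_density_le (R : realType) (B : sgraph) (gamma beta : R) :
  attainable B gamma beta -> min_density B gamma <= beta.
Proof. by apply: ge_inf; exists 0; exact: attainable_ge0. Qed.

Lemma removal_density (R : realType) (delta : R) : 0 < delta ->
  exists2 gam : R, 0 < gam & forall G : sgraph,
    density R (complete_graph 3) G < gam ->
    density R (complete_graph 3) G ^+ 4 <=
      81 * delta ^+ 2 * density R (complete_tripartite 1 2 2) G.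
Proof.
move=> /triangle_removal[gam gam0 H]; exists gam => // G.
rewrite density_triangle density_K122.
(* On the empty graph both densities are 0, because the inverse of 0 is 0. *)
have [G0|Gpos] := posnP #|G|.
  by rewrite G0 !expr0n /= invr0 !mulr0 expr0n.
have n0 : 0 < #|G|%:R :> R by rewrite ltr0n.
rewrite ltr_pdivrMr ?exprn_gt0 // => few.
have [|S [Sle hit]] := H G (@adj G).
  by move: few; rewrite /triangle_count !natr_sum; under eq_bigr => x _ do
    (rewrite natr_sum; under eq_bigr => y _ do rewrite natr_sum).
have := triangle_pow4_le (@adj_sym G) Sle hit.
rewrite expr_div_n mulrA ler_pdivrMr ?exprn_gt0 // => /le_trans; apply.
rewrite le_eqVlt; apply/orP; left; apply/eqP; field.
by rewrite lt0r_neq0.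
Qed.

Lemma truncn_harmonic_cvg (R : realType) (c : R) : 0 <= c ->
  (Num.truncn (c * i.+1%:R))%:R / i.+1%:R @[i --> \oo] --> c.
Proof.
move=> c0; apply: (@squeeze_cvgr _ _ _ _ (fun i => c - i.+1%:R^-1) (fun=> c)).
- near=> i; have i0 : 0 < i.+1%:R :> R by rewrite ltr0n.
  apply/andP; split; last by rewrite ler_pdivrMr // truncn_le mulr_ge0 // ltW.
  rewrite ler_pdivlMr // mulrBl mulVf ?lt0r_neq0 // lerBlDr natr1 ltW //.
  exact: truncnS_gt.
- by rewrite -[X in _ --> X]subr0; apply: cvgB; [exact: cvg_cst | exact: cvg_harmonic].
- exact: cvg_cst.
Unshelve. all: by end_near. Qed.

(* Blowing up [G] and adding isolated vertices lowers its triangle density to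
   any smaller positive value. *)
Lemma attainable_blowup (R : realType) (G : sgraph) (gamma : R) :
  (0 < #|G|)%N -> 0 < gamma -> gamma <= density R (complete_graph 3) G ->
  exists2 beta, attainable (complete_tripartite 1 2 2) gamma beta &
    beta <= density R (complete_tripartite 1 2 2) G.
Proof.
move=> Gpos gamma0 gammaG.
set T := density R (complete_graph 3) G in gammaG.
set K := density R (complete_tripartite 1 2 2) G.
have T0 : 0 < T := lt_le_trans gamma0 gammaG.
have n0 : 0 < #|G|%:R :> R by rewrite ltr0n.
(* Enlarging the vertex set by the factor mu with isolated vertices divides the triangle density by
   mu ^ 3, which has to be T / gamma. *)
pose mu : R := (T / gamma) `^ 3%:R^-1.
have mu3 : mu ^+ 3 = T / gamma.
  by rewrite -powR_mulrn ?powR_ge0 // -powRrM mulVf ?pnatr_eq0 // powRr1 // divr_ge0 ?ltW.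
have mu1 : 1 <= mu.
  have mu0 : 0 <= mu by exact: powR_ge0.
  by rewrite -(@ler_pXn2r _ 3) ?nnegrE // expr1n mu3 ler_pdivlMr // mul1r.
have mu0 : 0 < mu := lt_le_trans ltr01 mu1.
(* Number of isolated vertices per unit of blowup, so that the order of [Gs i] grows like mu * |G| *
   (i + 1). *)
pose c := (mu - 1) * #|G|%:R.
have c0 : 0 <= c by rewrite mulr_ge0 ?subr_ge0 // ltW.
pose s i := Num.truncn (c * i.+1%:R).
pose Gs i := blowup G i.+1 (s i).
pose rho i : R := #|Gs i|%:R / i.+1%:R.
have rho_cvg : rho i @[i --> \oo] --> #|G|%:R * mu.
  have -> : #|G|%:R * mu = #|G|%:R + c by rewrite /c; ring.
  have -> : rho = fun i => #|G|%:R + (s i)%:R / i.+1%:R.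
    by apply/funext => i; rewrite /rho card_blowup natrD natrM mulrDl mulfK ?pnatr_eq0.
  by apply: cvgD; [exact: cvg_cst | exact: truncn_harmonic_cvg].
have rho_pow m : (rho i ^+ m)^-1 @[i --> \oo] --> ((#|G|%:R * mu) ^+ m)^-1.
  apply: cvgV; first by rewrite expf_neq0 // mulf_neq0 ?lt0r_neq0.
  exact: (continuous_cvg _ (@exprn_continuous R m _) rho_cvg).
have rhoE m i : i.+1%:R ^+ m / #|Gs i|%:R ^+ m = (rho i ^+ m)^-1.
  by rewrite /rho expr_div_n invf_div.
exists (K / mu ^+ 5); last first.
  rewrite ler_pdivrMr ?exprn_gt0 // ler_peMr ?density_ge0 //.
  by rewrite exprn_ege1.
exists Gs; split.
- apply/cvgnyPge => A; near=> i; rewrite card_blowup.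
  apply: leq_trans (leq_addr _ _); apply: leq_trans (leq_pmull _ Gpos).
  by apply: leqW; near: i; exact: nbhs_infty_ge.
- have -> : gamma = (triangle_count (@adj G))%:R * ((#|G|%:R * mu) ^+ 3)^-1.
    rewrite exprMn mu3 /T density_triangle; field.
    rewrite (lt0r_neq0 gamma0) (lt0r_neq0 n0) /=.
    by apply: contraTneq T0; rewrite /T density_triangle => ->; rewrite mul0r ltxx.
  under eq_fun => i do rewrite density_triangle triangle_count_blowup natrM mulrAC natrX rhoE mulrC.
  by apply: cvgM; [exact: cvg_cst | exact: rho_pow].
- have -> : K / mu ^+ 5 = (K122_count (@adj G))%:R * ((#|G|%:R * mu) ^+ 5)^-1.
    by rewrite exprMn /K density_K122; field; rewrite !lt0r_neq0.
  under eq_fun => i do rewrite density_K122 K122_count_blowup natrM mulrAC natrX rhoE mulrC.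
  by apply: cvgM; [exact: cvg_cst | exact: rho_pow].
Unshelve. all: by end_near. Qed.

(** Up to constants depending on k, n is d ^ k and the number of triangles is at least d ^ (2k - 2).
    So the triangle density is at least of order d ^ -(k + 2), while that of K_{1,2,2} is at most n
    ^ -3; the ratio 3k / (k + 2) of exponents tends to 3. *)
Lemma sparse_graph_density (R : realType) (k d : nat) : (0 < d)%N ->
  exists G : sgraph, [/\ (0 < #|G|)%N,
    (k.+1 * 27 ^ k.+1)%:R^-1 / d%:R ^+ k.+2 <= density R (complete_graph 3) G
  & density R (complete_tripartite 1 2 2) G <= (d%:R ^+ k ^+ 3)^-1].
Proof.
move=> d0; have [G [Gcard GT GK]] := sparse_linear_graph k d.
have dR : 0 < d%:R :> R by rewrite ltr0n.
have dk0 : 0 < d%:R ^+ k :> R by rewrite exprn_gt0.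
have n0 : (0 < #|G|)%N by rewrite Gcard muln_gt0 /= expn_gt0 muln_gt0 d0.
have nR : 0 < #|G|%:R :> R by rewrite ltr0n.
exists G; split => //.
  rewrite density_triangle ler_pdivlMr ?exprn_gt0 //.
  have -> : #|G|%:R ^+ 3 = (27 ^ k.+1)%:R * d%:R ^+ k ^+ 3 :> R.
    rewrite Gcard -!natrX -natrM; congr (_%:R).
    have -> : (27 ^ k.+1 = 3 ^ 3 * (3 ^ k) ^ 3)%N by rewrite -expnM (mulnC k) expnM -expnS.
    by rewrite !expnMn mulnA.
  have hT : (d ^ (2 * k) <= triangle_count (@adj G) * (k.+1 * d ^ 2))%N.
    apply: leq_trans GT _; rewrite leq_mul2l; apply/orP; right.
    by rewrite mulSn -add1n leq_add2r expn_gt0 d0.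
  have hR : d%:R ^+ k ^+ 2 <= (triangle_count (@adj G))%:R * (k.+1%:R * d%:R ^+ 2) :> R.
    by rewrite -exprM mulnC -!natrX -!natrM ler_nat.
  rewrite -(ler_pM2r (x := k.+1%:R * d%:R ^+ 2)) ?mulr_gt0 ?exprn_gt0 //.
  apply: le_trans hR; rewrite natrM !exprS expr0 mulr1 le_eqVlt; apply/orP; left; apply/eqP.
  have k0 : 1 + k%:R != 0 :> R by rewrite nat1r pnatr_eq0.
  have e27 : (27 ^ k)%:R != 0 :> R by rewrite pnatr_eq0 expn_eq0.
  field.
  by rewrite ?k0 ?lt0r_neq0.
rewrite density_K122 ler_pdivrMr ?exprn_gt0 // mulrC ler_pdivlMr ?exprn_gt0 //.
have dn : d%:R ^+ k <= #|G|%:R :> R.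
  rewrite -natrX ler_nat Gcard expnMn mulnA leq_pmull // muln_gt0 expn_gt0 //.
apply: (@le_trans _ _ (#|G|%:R ^+ 2 * #|G|%:R ^+ 3)); last by rewrite -exprD.
apply: ler_pM => //.
  by rewrite -natrX ler_nat.
by rewrite ler_pXn2r ?nnegrE // ltW.
Qed.

Lemma attainable_upper_bound (R : realType) (eps : R) : 0 < eps ->
  exists2 gamma0 : R, 0 < gamma0 & forall gamma, 0 < gamma < gamma0 ->
    exists2 beta, attainable (complete_tripartite 1 2 2) gamma beta &
      beta <= gamma `^ (3 - eps).
Proof.
(* The exponent [p] is 3 - 6 / (k + 2), and k + 1 > 12 / eps makes it at least 3 - eps / 2. *)
move=> eps0; pose k := Num.truncn (12 / eps).
pose c : R := (k.+1 * 27 ^ k.+1)%:R^-1; pose C : R := 2 ^+ k.+2 / c.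
pose p : R := 3 * k%:R / k.+2%:R.
have c0 : 0 < c by rewrite invr_gt0 ltr0n muln_gt0 expn_gt0.
have c1 : c <= 1 by rewrite invf_le1 ?ler1n ?ltr0n muln_gt0 expn_gt0.
have C0 : 0 < C by rewrite divr_gt0 ?exprn_gt0.
have k2 : 0 < k.+2%:R :> R by rewrite ltr0n.
have p0 : 0 <= p by rewrite divr_ge0 ?mulr_ge0.
have pE : 3 - eps / 2 <= p.
  have : 12 < k.+1%:R * eps by rewrite -ltr_pdivrMr //; exact: truncnS_gt.
  rewrite /p ler_pdivlMr // -[k.+2%:R]natr1 -[k.+1%:R]natr1.
  lra.
(* gamma < c lets d = 1 fit; the second bound gives gamma ^ (eps / 2) <= C ^ (-p), which absorbs the
   constant C ^ p at the end. *)
exists (Num.min c ((C `^ (- p)) `^ (2 / eps))) => [|gamma].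
  by rewrite lt_min c0 !powR_gt0.
rewrite lt_min => /and3P[gamma0 gammac gammaC].
have gamma1 : gamma <= 1 := le_trans (ltW gammac) c1.
(* [fits d] says that the guaranteed triangle density c / d ^ (k + 2) still reaches gamma; the
   largest such d gives the best bound for K_{1,2,2}. *)
pose fits d := gamma * d%:R ^+ k.+2 <= c.
have exd : exists d, fits d by exists 1%N; rewrite /fits expr1n mulr1 ltW.
have ubd d : fits d -> (d <= Num.truncn (c / gamma))%N.
  rewrite /fits mulrC -ler_pdivlMr // -natrX => h.
  rewrite -ltnS -(ltr_nat R); apply: le_lt_trans (truncnS_gt _); apply: le_trans h.
  by rewrite ler_nat; case: d => // d; rewrite expnS leq_pmulr // expn_gt0.
have [d fitd maxd] := ex_maxnP exd ubd.
have d0 : (0 < d)%N by apply: maxd; rewrite /fits expr1n mulr1 ltW.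
have dR : 0 < d%:R :> R by rewrite ltr0n.
have [G [Gpos GT GK]] := sparse_graph_density R k d0.
have [|beta att betaG] := attainable_blowup Gpos gamma0 (gamma := gamma).
  by apply: le_trans GT; rewrite ler_pdivlMr ?exprn_gt0.
exists beta => //; apply: (le_trans betaG); apply: (le_trans GK).
pose x : R := (d%:R ^+ k.+2)^-1.
have x0 : 0 <= x by rewrite invr_ge0 exprn_ge0 // ltW.
have xC : x <= C * gamma.
  rewrite /x -[leLHS]mul1r ler_pdivrMr ?exprn_gt0 // /C.
  (* By maximality of d, its double does not fit; the loss is the factor 2 ^ (k + 2) in [C]. *)
  have : c < gamma * (2 * d%:R) ^+ k.+2.
    rewrite ltNge -natrM; apply/negP => /maxd.
    by rewrite mul2n -addnn -{3}(addn0 d) leq_add2l leqn0 => /eqP d00; rewrite d00 in d0.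
  rewrite exprMn => /ltW h.
  have -> : 2 ^+ k.+2 / c * gamma * d%:R ^+ k.+2 = gamma * (2 ^+ k.+2 * d%:R ^+ k.+2) / c by ring.
  by rewrite ler_pdivlMr // mul1r.
have -> : (d%:R ^+ k ^+ 3)^-1 = x `^ p.
  rewrite /x -!powR_mulrn ?powR_ge0 ?(ltW dR) // -!powRN -!powRrM; congr (_ `^ _).
  by rewrite /p; field; rewrite lt0r_neq0.
apply: (@le_trans _ _ ((C * gamma) `^ p)).
  by rewrite ge0_ler_powR // nnegrE // mulr_ge0 // ltW.
rewrite powRM ?(ltW C0) ?(ltW gamma0) //.
have h1 : gamma `^ p <= gamma `^ (3 - eps) * gamma `^ (eps / 2).
  rewrite -powRD; last by rewrite (lt0r_neq0 gamma0) implybT.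
  have -> : 3 - eps + eps / 2 = 3 - eps / 2 by field.
  by apply: ger_powR => //; rewrite gamma0.
have h2 : gamma `^ (eps / 2) <= C `^ (- p).
  have -> : C `^ (- p) = ((C `^ (- p)) `^ (2 / eps)) `^ (eps / 2).
    rewrite -[RHS]powRrM (_ : 2 / eps * (eps / 2) = 1) ?powRr1 ?powR_ge0 //.
    by field; rewrite lt0r_neq0.
  apply: ge0_ler_powR; rewrite ?nnegrE ?powR_ge0 ?divr_ge0 ?(ltW eps0) ?(ltW gamma0) //.
  exact: ltW.
have Cp : C `^ p * C `^ (- p) = 1.
  by rewrite powRN mulfV // lt0r_neq0 // powR_gt0.
apply: (@le_trans _ _ (C `^ p * (gamma `^ (3 - eps) * C `^ (- p)))).
  rewrite ler_wpM2l ?powR_ge0 //; apply: le_trans h1 _.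
  by rewrite ler_wpM2l ?powR_ge0.
by rewrite mulrCA Cp mulr1.
Qed.

Lemma attainable_lower_bound (R : realType) (A : R) :
  exists2 gamma0 : R, 0 < gamma0 & forall gamma beta, 0 < gamma < gamma0 ->
    attainable (complete_tripartite 1 2 2) gamma beta -> A * gamma ^+ 4 <= beta.
Proof.
(* With delta = 1 / (9 * B) the factor 81 * delta ^ 2 is 1 / B ^ 2, and B ^ 2 >= A. *)
pose B := 1 + `|A|; have B1 : 1 <= B by rewrite lerDl.
have B0 : 0 < B := lt_le_trans ltr01 B1.
have [|gam gam0 H] := @removal_density R (9 * B)^-1; first by rewrite invr_gt0 mulr_gt0.
exists gam => // gamma beta /andP[gamma0 gammagam] [G [_ GT GK]].
have lim4 : density R (complete_graph 3) (G i) ^+ 4 @[i --> \oo] --> gamma ^+ 4.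
  exact: (continuous_cvg _ (@exprn_continuous R 4 _) GT).
have limK : 81 * (9 * B)^-1 ^+ 2 * density R (complete_tripartite 1 2 2) (G i)
    @[i --> \oo] --> 81 * (9 * B)^-1 ^+ 2 * beta.
  by apply: cvgM GK; exact: cvg_cst.
have hB : gamma ^+ 4 <= 81 * (9 * B)^-1 ^+ 2 * beta.
  apply: (ler_cvg_to lim4 limK); near=> i; apply: H.
  by near: i; exact: (cvgr_lt _ GT).
have AB : A <= B ^+ 2.
  apply: le_trans (ler_norm A) _; apply: (@le_trans _ _ B); first by rewrite lerDr.
  by rewrite expr2 ler_peMl // ltW.
apply: (@le_trans _ _ (B ^+ 2 * gamma ^+ 4)).
  by rewrite ler_wpM2r // exprn_ge0 // ltW.
have -> : beta = B ^+ 2 * (81 * (9 * B)^-1 ^+ 2 * beta) by field; rewrite lt0r_neq0.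
by rewrite ler_wpM2l // sqr_ge0.
Unshelve. all: by end_near. Qed.

Theorem theorem5 (R : realType) :
  (min_density (complete_tripartite 1 2 2) gamma / gamma ^+ 4
     @[gamma --> (0 : R)^'+] --> +oo)
  /\
  (forall eps : R, 0 < eps ->
     exists2 gamma0 : R, 0 < gamma0 &
       forall gamma : R, 0 < gamma < gamma0 ->
         min_density (complete_tripartite 1 2 2) gamma <= gamma `^ (3 - eps)).
Proof.
split=> [|eps eps0].
  apply/cvgryPge => A.
  have [g1 g10 lower] := attainable_lower_bound A.
  (* The upper bound, here with eps = 1, shows that the set under the infimum is nonempty, so that
     its lower bounds pass to [inf]. *)
  have [g2 g20 upper] := @attainable_upper_bound R 1 ltr01.
  near=> gamma.
  have gamma0 : 0 < gamma by near: gamma; exact: nbhs_right_gt.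
  have lt1 : gamma < g1 by near: gamma; exact: nbhs_right_lt.
  have lt2 : gamma < g2 by near: gamma; exact: nbhs_right_lt.
  rewrite ler_pdivlMr ?exprn_gt0 //; apply: lb_le_inf.
    by have [|beta att _] := upper gamma; [rewrite gamma0 | exists beta].
  by move=> beta; apply: lower; rewrite gamma0.
have [g0 g00 upper] := attainable_upper_bound eps0; exists g0 => // gamma /upper[beta att].
exact: le_trans (min_density_le att).
Unshelve. all: by end_near. Qed.
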